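(* Let $\mathcal{A}\subset B(\mathfrak{H})$ be an operator algebra with dimension $d$. Then there is a positive integer $r\geq 1$, a subalgebra $\mathcal{B}\subset\mathbb{M}_r$ and a completely contractive algebra isomorphism $\Phi:\mathcal{A}\to\mathcal{B}$ with $\|\Phi^{-1}\|_{cb}\leq 2d$. If $\mathcal{A}$ is unital, then $\Phi$ can be chosen to be unital.
   Context: An operator algebra is a norm closed subalgebra of $B(\mathfrak{H})$, $\mathfrak{H}$ a complex Hilbert space; it is unital if it contains the identity on $\mathfrak{H}$. $\mathbb{M}_r=\mathbb{M}_r(\mathbb{C})$ with the operator norm. $\mathbb{M}_n(\mathcal{A})$ has the norm inherited from $B(\mathfrak{H}^{(n)})$; for a linear map $\phi$, $\phi^{(n)}$ denotes the entrywise ampliation, $\|\phi\|_{cb}=\sup_n\|\phi^{(n)}\|$, and $\phi$ is completely contractive if $\|\phi\|_{cb}\le 1$. Here $d$ is the (finite) vector space dimension of $\mathcal{A}$. *)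

(* Defs.v *)
From HB Require Import structures.
From mathcomp Require Import all_boot all_order all_algebra sesquilinear.
From mathcomp Require Import all_classical all_reals all_analysis.
From mathcomp Require Import complex.

Set Implicit Arguments.
Unset Strict Implicit.
Unset Printing Implicit Defensive.

Import Order.TTheory GRing.Theory Num.Theory.
Import numFieldNormedType.Exports.

Local Open Scope classical_set_scope.
Local Open Scope complex_scope.
Local Open Scope ring_scope.

(* All operator norms are suprema in [\bar R], so that an unbounded operator
   has norm [+oo] and no junk value can occur. *)
Definition opnorm (R : realType) (V : Type) (N : V -> R) (T : V -> V) : \bar R :=
  ereal_sup [set (N (T x))%:E | x in [set x | N x <= 1]].

Definition l2norm (R : realType) (V : Type) (N : V -> R) (n : nat)
    (x : 'I_n -> V) : R :=
  Num.sqrt (\sum_i N (x i) ^+ 2).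

(* Elements of [aT] act on [V]; an n x n matrix over [aT] acts on the l2-direct
   sum of n copies of [V], by the usual matrix-vector formula. *)
Definition mx_opnorm (R : realType) (aT : Type) (V : zmodType)
    (act : aT -> V -> V) (N : V -> R) (n : nat) (X : 'M[aT]_n) : \bar R :=
  opnorm (@l2norm R V N n) (fun x i => \sum_j act (X i j) (x j)).

(* The norm of the n-th ampliation, and the completely bounded norm, of
   [f : A -> bT], where [NA] and [NB] are the norms on matrices over [aT] and
   [bT]; only the values of [f] on [A] matter. *)
Definition ampl_norm (R : realType) (aT bT : Type)
    (NA : forall n, 'M[aT]_n -> \bar R) (NB : forall n, 'M[bT]_n -> \bar R)
    (A : set aT) (f : aT -> bT) (n : nat) : \bar R :=
  ereal_sup [set NB n (map_mx f X) | X in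
    [set X : 'M[aT]_n | (forall i j, A (X i j)) /\ (NA n X <= 1)%E]].

Definition cb_norm (R : realType) (aT bT : Type)
    (NA : forall n, 'M[aT]_n -> \bar R) (NB : forall n, 'M[bT]_n -> \bar R)
    (A : set aT) (f : aT -> bT) : \bar R :=
  ereal_sup [set ampl_norm NA NB A f n | n in [set n | (0 < n)%N]].

Definition has_dimension (K : fieldType) (V : lmodType K) (A : set V)
    (d : nat) : Prop :=
  exists b : 'I_d -> V,
    [/\ forall i, A (b i),
        forall c : 'I_d -> K, \sum_i c i *: b i = 0 -> forall i, c i = 0
      & forall v, A v -> exists c : 'I_d -> K, v = \sum_i c i *: b i].

Section Hilbert.
Context {R : realType} (H : completeNormedModType R[i]).

(* The norm of [H] takes its (real) values in [R[i]]. *)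
Definition hnorm (x : H) : R := complex.Re `|x|.

Definition bounded_operator (T : H -> H) : Prop :=
  linear T /\ (opnorm hnorm T < +oo)%E.

Definition norm_closed (A : set (H -> H)) : Prop :=
  forall T, bounded_operator T ->
    (forall e : R, 0 < e ->
       exists2 S, A S & (opnorm hnorm (T - S)%R < e%:E)%E) ->
    A T.

Definition operator_algebra (A : set (H -> H)) : Prop :=
  [/\ A `<=` bounded_operator,
      submod_closed [in A],
      forall S T, A S -> A T -> A (S \o T)
    & norm_closed A].

Definition bh_mxnorm (n : nat) (X : 'M[H -> H]_n) : \bar R :=
  mx_opnorm (fun T : H -> H => T) hnorm X.

End Hilbert.

Section Matrices.
Context {R : realType} (r : nat).

Definition euclid_norm (v : 'cV[R[i]]_r) : R :=
  l2norm (fun z : R[i] => complex.Re `|z|) (fun i => v i 0).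

Definition mr_mxnorm (n : nat) (X : 'M['M[R[i]]_r]_n) : \bar R :=
  mx_opnorm (fun (M : 'M[R[i]]_r) (v : 'cV[R[i]]_r) => M *m v) euclid_norm X.

Definition matrix_subalgebra (B : set 'M[R[i]]_r) : Prop :=
  submod_closed [in B] /\ (forall M N, B M -> B N -> B (M *m N)).

End Matrices.

(* [Phi] restricts to an algebra isomorphism of [A] onto [B], and [Psi]
   restricts to its inverse. *)
Definition algebra_iso (R : realType) (H : completeNormedModType R[i])
    (r : nat) (A : set (H -> H)) (B : set 'M[R[i]]_r)
    (Phi : (H -> H) -> 'M[R[i]]_r) (Psi : 'M[R[i]]_r -> (H -> H)) : Prop :=
  [/\ forall (a : R[i]) S T, A S -> A T ->
        Phi (a *: S + T) = a *: Phi S + Phi T,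
      forall S T, A S -> A T -> Phi (S \o T) = Phi S *m Phi T,
      forall T, A T -> B (Phi T) /\ Psi (Phi T) = T
    & forall M, B M -> A (Psi M) /\ Phi (Psi M) = M].

(* Main.v *)
Require Import Defs.
From HB Require Import structures.
From mathcomp Require Import all_boot all_order all_algebra sesquilinear.
From mathcomp Require Import all_classical all_reals all_analysis.
From mathcomp Require Import complex.
From mathcomp Require Import perm ring lra.

(** The representation is the restriction of [A] to a finite dimensional
    invariant subspace [L], which is automatically a completely contractive (and
    unital) homomorphism.  A finite net of the unit ball of [A] provides finitely
    many vectors that norm [A] up to the factor 3/2, and [L] is spanned by these
    vectors and their images under [A].  Nearly maximising a determinant over the
    unit ball of [A] gives a basis [b_k] of contractions whose coordinate
    functionals [f_k] have norm at most 4/3 on [A], hence at most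
    4/3 * 3/2 = 2 with respect to the norm of [L].  Functionals have equal norm
    and cb-norm, so the inverse [T|_L |-> sum_k f_k(T) b_k] has cb-norm at most
    [2 d]. *)

Set Implicit Arguments.
Unset Strict Implicit.
Unset Printing Implicit Defensive.

Import Order.TTheory GRing.Theory Num.Theory.
Import numFieldNormedType.Exports.

Local Open Scope classical_set_scope.
Local Open Scope complex_scope.
Local Open Scope ring_scope.

(** * Real-valued form of the [R[i]]-valued norm *)

Definition rnorm (R : rcfType) (V : normedZmodType R[i]) (x : V) : R :=
  complex.Re `|x|.

Section RealNorm.
Context {R : rcfType} {V : normedZmodType R[i]}.
Implicit Types x y : V.

Lemma normr_rnorm x : `|x| = (rnorm x)%:C.
Proof. by rewrite /rnorm RRe_real// normr_real. Qed.

Lemma rnorm_ge0 x : 0 <= rnorm x.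
Proof. by rewrite -ler0c -normr_rnorm. Qed.

Lemma rnorm0 : rnorm (0 : V) = 0.
Proof. by rewrite /rnorm normr0. Qed.

Lemma rnorm_eq0 x : rnorm x = 0 -> x = 0.
Proof. by move=> x0; apply/normr0_eq0; rewrite normr_rnorm x0. Qed.

Lemma ler_rnormD x y : rnorm (x + y) <= rnorm x + rnorm y.
Proof. by rewrite -lecR rmorphD/= -!normr_rnorm ler_normD. Qed.

Lemma rnormN x : rnorm (- x) = rnorm x.
Proof. by rewrite /rnorm normrN. Qed.

Lemma rnormB x y : rnorm (x - y) = rnorm (y - x).
Proof. by rewrite /rnorm distrC. Qed.

Lemma ler_rnorm_sum (I : finType) (F : I -> V) :
  rnorm (\sum_i F i) <= \sum_i rnorm (F i).
Proof.
elim/big_ind2: _ => // [|x a y b xa yb]; first by rewrite rnorm0.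
exact: le_trans (ler_rnormD _ _) (lerD xa yb).
Qed.

End RealNorm.

Section RealNormScalar.
Context {R : realType}.
Implicit Types z w : R[i].

Lemma rnormM z w : rnorm (z * w) = rnorm z * rnorm w.
Proof. by apply: complexI; rewrite rmorphM/= -!normr_rnorm normrM. Qed.

Lemma rnorm1 : rnorm (1 : R[i]) = 1.
Proof. by apply: complexI; rewrite -normr_rnorm normr1. Qed.

Lemma rnorm_real (k : R) : rnorm (k%:C) = `|k|.
Proof. by rewrite /rnorm normc_def/= expr0n/= addr0 sqrtr_sqr. Qed.

Lemma rnorm_conj z : rnorm z^* = rnorm z.
Proof. by rewrite /rnorm norm_conjC. Qed.

Lemma mul_conj_rnorm z : z * z^* = (rnorm z ^+ 2)%:C.
Proof. by rewrite -normCK normr_rnorm -rmorphXn. Qed.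

Lemma rnormZ (V : normedModType R[i]) z (x : V) :
  rnorm (z *: x) = rnorm z * rnorm x.
Proof. by apply: complexI; rewrite rmorphM/= -!normr_rnorm normrZ. Qed.

Lemma rnorm_le_ReIm z :
  rnorm z <= `|complex.Re z| + `|complex.Im z|.
Proof.
rewrite {1}[z]complexE (le_trans (ler_rnormD _ _))// rnormM !rnorm_real.
by rewrite [X in X * _](_ : _ = 1) ?mul1r// /rnorm normc_def/= expr0n expr1n add0r sqrtr1.
Qed.

Lemma Re_le_rnorm z : `|complex.Re z| <= rnorm z.
Proof. by rewrite -lecR -normr_rnorm normc_ge_Re. Qed.

Lemma Im_le_rnorm z : `|complex.Im z| <= rnorm z.
Proof.
have -> : complex.Im z = - complex.Re (z * 'i%C) by rewrite ReiNIm opprK.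
rewrite normrN (le_trans (Re_le_rnorm _))// rnormM.
by rewrite [X in _ * X](_ : _ = 1) ?mulr1// /rnorm normc_def/= expr0n expr1n add0r sqrtr1.
Qed.

End RealNormScalar.

(** * Cauchy-Schwarz and Minkowski inequalities for finite l2 sums *)

Section L2.
Context {R : realType} {n : nat}.
Implicit Types a b : 'I_n -> R.

Lemma sqr_sum_ge0 a : 0 <= \sum_i a i ^+ 2.
Proof. by apply: sumr_ge0 => i _; rewrite sqr_ge0. Qed.

Lemma sum_mul_le_sqrt a b :
  \sum_i a i * b i <= Num.sqrt (\sum_i a i ^+ 2) * Num.sqrt (\sum_i b i ^+ 2).
Proof.
set A := \sum_i a i ^+ 2; set B := \sum_i b i ^+ 2; set c := \sum_i _.
have A0 : 0 <= A := sqr_sum_ge0 a; have B0 : 0 <= B := sqr_sum_ge0 b.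
(* The sum of the squares [(B * a i - c * b i) ^+ 2] expands to [B * (A * B - c ^+ 2)]. Dividing by
   [B] is possible unless all the [b i] vanish. *)
have key : 0 <= B * (A * B - c ^+ 2).
  rewrite (_ : _ * _ = \sum_i (B * a i - c * b i) ^+ 2) ?sqr_sum_ge0//.
  rewrite (eq_bigr (fun i => B ^+ 2 * a i ^+ 2 + (- 2 * B * c) * (a i * b i)
    + c ^+ 2 * b i ^+ 2)); last by move=> i _; ring.
  by rewrite !big_split/= -!mulr_sumr -/A -/B -/c; ring.
have [B_eq0|B_neq0] := eqVneq B 0.
  rewrite [c]big1 ?mulr_ge0 ?sqrtr_ge0// => i _.
  move/eqP: B_eq0; rewrite psumr_eq0; last by move=> j _; rewrite sqr_ge0.
  by move/allP/(_ i (mem_index_enum _)); rewrite sqrf_eq0 => /eqP ->; rewrite mulr0.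
have {key} : 0 <= A * B - c ^+ 2 by rewrite -(pmulr_rge0 _ (_ : 0 < B))// lt_def B_neq0.
rewrite subr_ge0 -sqrtrM// => cAB.
by rewrite (le_trans (ler_norm c))// -sqrtr_sqr ler_sqrt// mulr_ge0.
Qed.

End L2.

Section L2norm.
Context {R : realType} {V : Type} (N : V -> R) {n : nat}.
Implicit Types x y : 'I_n -> V.

Lemma l2norm_ge0 x : 0 <= l2norm N x.
Proof. exact: sqrtr_ge0. Qed.

Lemma l2norm_sqr x : l2norm N x ^+ 2 = \sum_i N (x i) ^+ 2.
Proof. by rewrite sqr_sqrtr// sqr_sum_ge0. Qed.

Lemma l2norm_le x (K : R) : 0 <= K ->
  \sum_i N (x i) ^+ 2 <= K ^+ 2 -> l2norm N x <= K.
Proof.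
by move=> K0 xK; rewrite -(ler_pXn2r (_ : 0 < 2)%N)// ?nnegrE ?l2norm_ge0// l2norm_sqr.
Qed.

End L2norm.

Section L2triangle.
Context {R : realType} {V : normedZmodType R[i]} {n : nat}.
Implicit Types x y : 'I_n -> V.

Lemma l2normD x y : l2norm (@rnorm R V) (fun i => x i + y i) <=
  l2norm (@rnorm R V) x + l2norm (@rnorm R V) y.
Proof.
have x0 := l2norm_ge0 (@rnorm R V) x; have y0 := l2norm_ge0 (@rnorm R V) y.
apply: l2norm_le; first exact: addr_ge0.
rewrite sqrrD !l2norm_sqr.
apply: (@le_trans _ _ (\sum_i (rnorm (x i) + rnorm (y i)) ^+ 2)).
  by apply: ler_sum => i _; rewrite ler_pXn2r ?nnegrE ?addr_ge0 ?rnorm_ge0 ?ler_rnormD.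
under eq_bigr do rewrite sqrrD; rewrite !big_split/= lerD2r lerD2l -mulr2n lerMn2r/=.
exact: sum_mul_le_sqrt.
Qed.

Lemma l2norm_sum (I : finType) (u : I -> 'I_n -> V) :
  l2norm (@rnorm R V) (fun i => \sum_k u k i) <=
  \sum_k l2norm (@rnorm R V) (u k).
Proof.
have -> : (fun i => \sum_k u k i) = \sum_k u k by rewrite fct_sumE.
elim/big_ind2: _ => [|s f t g fs gt|//].
  rewrite /l2norm big1 ?sqrtr0// => i _.
  by rewrite [X in rnorm X](_ : _ = 0)// rnorm0 expr0n.
exact: le_trans (l2normD f g) (lerD fs gt).
Qed.

End L2triangle.

(** * Cauchy-Schwarz and Gram-Schmidt in the Hilbert space *)

Section InnerProduct.
Context {R : realType} {H : completeNormedModType R[i]}.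
Variable inner : {dot H for @Num.conj R[i]}.
Hypothesis inner_norm : forall x : H, `|x| ^+ 2 = inner x x.

Lemma inner_rnorm x : inner x x = (rnorm x ^+ 2)%:C.
Proof. by rewrite -inner_norm normr_rnorm -rmorphXn. Qed.

Lemma innerC x y : inner x y = (inner y x)^*.
Proof. by rewrite hermC expr0 mul1r. Qed.

Lemma rnorm_inner_le x y : rnorm (inner x y) <= rnorm x * rnorm y.
Proof.
have [->|y0] := eqVneq y 0; first by rewrite linear0r !rnorm0 mulr0.
have ny : 0 < rnorm y.
  by rewrite lt_def rnorm_ge0 andbT; apply: contra_neq y0; exact: rnorm_eq0.
pose b := rnorm y ^+ 2; pose c := inner x y.
have : 0 <= inner (b%:C *: x - c *: y) (b%:C *: x - c *: y) by exact: dnorm_ge0.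
rewrite dnormB !dnormZ !inner_rnorm linearZl_LR linearZr_LR/= -/c.
rewrite [c^* * c]mulrC mul_conj_rnorm !normr_rnorm rnorm_real -rmorphM/=.
rewrite -!rmorphXn/= -!rmorphM/=.
(* The two cross terms are conjugate to each other, and the first is already known to be real. *)
rewrite [X in _ - (_ + X)](_ : _ = (b * rnorm c ^+ 2)%:C); last first.
  by apply/CrealP; apply/complex_realP; exists (b * rnorm c ^+ 2).
rewrite -!rmorphD -rmorphB/= ler0c real_normK ?num_real// => h.
have {h} : 0 <= b * (b * rnorm x ^+ 2 - rnorm c ^+ 2).
  by apply: le_trans h _; rewrite le_eqVlt; apply/orP; left; apply/eqP; rewrite /b; ring.
rewrite pmulr_rge0 ?exprn_gt0// subr_ge0 /b => h.
by rewrite -(ler_pXn2r (_ : 0 < 2)%N)// ?nnegrE ?mulr_ge0 ?rnorm_ge0// exprMn mulrC.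
Qed.

Definition orthonormal_family r (e : 'I_r -> H) :=
  forall i j, inner (e i) (e j) = (i == j)%:R.

Lemma inner_sum_orthonormal r (e : 'I_r -> H) (z : 'I_r -> R[i]) j :
  orthonormal_family e -> inner (\sum_i z i *: e i) (e j) = z j.
Proof.
move=> eo; rewrite linear_sumlz (bigD1 j)//= linearZl_LR/= eo eqxx mulr1.
by rewrite big1 ?addr0// => i /negPf ij; rewrite linearZl_LR/= eo ij mulr0.
Qed.

Lemma rnorm_sum_orthonormal r (e : 'I_r -> H) (z : 'I_r -> R[i]) :
  orthonormal_family e -> rnorm (\sum_i z i *: e i) = l2norm (@rnorm R R[i]) z.
Proof.
move=> eo; rewrite -[LHS]ger0_norm ?rnorm_ge0// -sqrtr_sqr /l2norm; congr Num.sqrt.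
apply: complexI; rewrite -inner_rnorm linear_sumr rmorph_sum; apply: eq_bigr => i _.
by rewrite linearZr_LR/= inner_sum_orthonormal// mulrC mul_conj_rnorm.
Qed.

(** Vectors that depend on the earlier ones are dropped, so [r] may be smaller than the size of [s].
    The last clause places each [e i] in the span of [s], in the form of an induction principle over
    subspaces: a property of the generators that is stable under linear combinations passes to the
    frame. *)
Lemma gram_schmidt (s : seq H) : exists r (e : 'I_r -> H),
  [/\ orthonormal_family e,
      forall x, x \in s -> x = \sum_i inner x (e i) *: e i
    & forall P : set H, P 0 -> (forall a x y, P x -> P y -> P (a *: x + y)) ->
        (forall x, x \in s -> P x) -> forall i, P (e i)].
Proof.
elim: s => [|x s [r [e [eo es eP]]]].
  by exists 0%N, (fun=> 0); split=> // - [].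
pose p := \sum_i inner x (e i) *: e i; pose w := x - p.
have we j : inner w (e j) = 0.
  by rewrite linearBl/= inner_sum_orthonormal// subrr.
have PD (P : set H) : P 0 -> (forall a x y, P x -> P y -> P (a *: x + y)) ->
    (forall y, y \in x :: s -> P y) -> P w /\ forall i, P (e i).
  move=> P0 PL Ps; have Pe : forall i, P (e i).
    by apply: eP => // y ys; apply: Ps; rewrite inE ys orbT.
  split=> //; rewrite /w addrC -scaleN1r; apply: (PL); last first.
    by apply: Ps; rewrite inE eqxx.
  rewrite /p; elim/big_ind: _ => //.
  - by move=> u v Pu Pv; rewrite -[u]scale1r; apply: (PL).
  - by move=> i _; rewrite -[_ *: _]addr0; apply: (PL).
have [w0|w0] := eqVneq w 0.
  exists r, e; split=> //.
  - move=> y; rewrite inE => /orP[/eqP->|/es//].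
    by move/eqP: w0; rewrite subr_eq0 => /eqP.
  - by move=> P P0 PL /(PD P P0 PL)[].
have nw : (rnorm w)%:C != 0 :> R[i].
  by apply: contra_neq w0 => /complexI/rnorm_eq0.
pose e0 := (rnorm w)%:C^-1 *: w.
have e0e j : inner e0 (e j) = 0 by rewrite linearZl_LR/= we mulr0.
have ee0 j : inner (e j) e0 = 0 by rewrite innerC e0e rmorph0.
have nw2 : (rnorm w)%:C^-1^* = (rnorm w)%:C^-1 :> R[i].
  by apply/CrealP; rewrite realV; apply/complex_realP; exists (rnorm w).
have e00 : inner e0 e0 = 1.
  rewrite linearZl_LR linearZr_LR/= inner_rnorm nw2 rmorphXn/= expr2.
  by rewrite mulrA mulrA -mulrA mulrACA mulVf// !mul1r// mulVf.
pose e' i := if unlift ord0 i is Some j then e j else e0.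
have e'0 : e' ord0 = e0 by rewrite /e' unlift_none.
have e'S j : e' (lift ord0 j) = e j by rewrite /e' liftK.
have e's y : \sum_i inner y (e' i) *: e' i =
    inner y e0 *: e0 + \sum_i inner y (e i) *: e i.
  by rewrite big_ord_recl e'0; congr (_ + _); apply: eq_bigr => i _; rewrite e'S.
exists r.+1, e'; split.
- move=> i j; case: (unliftP ord0 i) => [i'|] ->; case: (unliftP ord0 j) => [j'|] ->;
    rewrite ?e'0 ?e'S ?eo ?e00 ?e0e ?ee0 ?eqxx ?(inj_eq (@lift_inj _ _))//.
- move=> y; rewrite inE e's => /orP[/eqP->|ys].
    have xwp : x = w + p by rewrite subrK.
    rewrite -/p {1}xwp; congr (_ + _).
    have -> : inner x e0 = (rnorm w)%:C.
      rewrite xwp linearDl/= [X in _ + X]linear_sumlz big1 ?addr0.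
        by rewrite linearZr_LR/= inner_rnorm nw2 rmorphXn/= expr2 mulrA mulVf// mul1r.
      by move=> i _; rewrite linearZl_LR/= ee0 mulr0.
    by rewrite scalerA divff// scale1r.
  have -> : inner y e0 = 0.
    rewrite (es y ys) linear_sumlz big1// => i _.
    by rewrite linearZl_LR/= ee0 mulr0.
  by rewrite scale0r add0r; exact: es.
- move=> P P0 PL /(PD P P0 PL)[Pw Pe] i; rewrite /e'.
  by case: unlift => // ; rewrite /e0 -[_ *: _]addr0; apply: (PL).
Qed.

End InnerProduct.

(** * Linear algebra, finite nets and determinant estimates *)

Lemma separating_rows_full (K : fieldType) d (S : set 'rV[K]_d) :
  (forall c : 'cV_d, (forall s, S s -> s *m c = 0) -> c = 0) ->
  exists n (M : 'M[K]_(n, d)), (forall i, S (row i M)) /\ row_full M.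
Proof.
move=> Ssep; suff /(_ d (leqnn d)) : forall k, (k <= d)%N ->
    exists n (M : 'M[K]_(n, d)), (forall i, S (row i M)) /\ (k <= \rank M)%N.
  move=> [n [M [SM rM]]]; exists n, M; split=> //.
  by rewrite /row_full eqn_leq rank_leq_col.
elim=> [_|k IH kd]; first by exists 0%N, 0; split=> // - [].
have [n [M [SM]]] := IH (ltnW kd).
rewrite leq_eqVlt => /orP[/eqP kM|]; last by exists n, M.
(* A nonzero column of [cokermx M] is killed by every row of [M]. Separation gives an [s] in [S]
   that does not kill it, so appending [s] raises the rank. *)
have : cokermx M != 0 by rewrite cokermx_eq0 /row_full -kM neq_ltn kd.
move=> /eqP/matrixP nz; have [j cj] : exists j, col j (cokermx M) != 0.
  apply/not_existsP => h; apply: nz => i j.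
  have := h j; move/negP; rewrite negbK => /eqP/colP/(_ i).
  by rewrite !mxE.
have [s [Ss sM]] : exists s, S s /\ s *m col j (cokermx M) != 0.
  apply/not_existsP => h; move/eqP: cj; apply; apply: Ssep => s Ss.
  by apply/eqP/negPn/negP => sc; apply: (h s).
have nsM : ~~ (s <= M)%MS.
  rewrite submxE; apply: contra sM => /eqP s0.
  by rewrite colE mulmxA s0 mul0mx.
exists (n + 1)%N, (col_mx M s); split=> [i|].
  by case: (split_ordP i) => j' ->; rewrite ?rowKu ?rowKd ?row_id.
rewrite kM; apply: rank_ltmx; rewrite ltmxE.
have := addsmxE M s; move=> h; rewrite -!h addsmxSl/= addsmx_sub submx_refl//=.
Qed.

Section Nets.
Context {R : realType}.

Lemma real_net (C e : R) : 0 < e -> exists s : seq R, forall x, `|x| <= C ->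
  exists2 w, w \in s & `|x - w| <= e.
Proof.
move=> e0; pose N := (Num.truncn ((C + C) / e)).+1.
exists [seq e * k%:R - C | k <- iota 0 N] => x.
rewrite ler_norml => /andP[Cx xC]; have y0 : 0 <= (x + C) / e.
  by apply: divr_ge0; lra.
have /andP[k1 k2] := truncn_itv y0; set k := Num.truncn _ in k1 k2.
exists (e * k%:R - C).
  apply/mapP; exists k => //; rewrite mem_iota /= add0n ltnS le_truncn//.
  by rewrite ler_pM2r ?invr_gt0// lerD2r.
move: k1 k2; rewrite ler_pdivlMr// ltr_pdivrMr// -natr1 => k1 k2.
by rewrite ler_norml; apply/andP; split; lra.
Qed.

Lemma complex_net (C e : R) : 0 < e -> exists s : seq R[i], forall z,
  rnorm z <= C -> exists2 w, w \in s & rnorm (z - w) <= e.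
Proof.
move=> e0; have e20 : 0 < e / 2 by rewrite divr_gt0.
have [s sP] := real_net C e20.
exists [seq (a +i* b)%C | a <- s, b <- s] => z zC.
have [a a_s ha] := sP _ (le_trans (Re_le_rnorm z) zC).
have [b b_s hb] := sP _ (le_trans (Im_le_rnorm z) zC).
exists (a +i* b)%C; first by apply: allpairs_f.
rewrite (le_trans (rnorm_le_ReIm _))//.
by case: z zC ha hb => x y _ /= ha hb; lra.
Qed.

Lemma row_net d (C e : R) : 0 < e -> exists s : seq 'rV[R[i]]_d,
  forall c : 'rV[R[i]]_d, (forall k, rnorm (c 0 k) <= C) ->
  exists2 g, g \in s & forall k, rnorm (c 0 k - g 0 k) <= e.
Proof.
move=> e0; have [s sP] := complex_net C e0.
(* All choices of [d] points of the scalar net, enumerated through the finite type of index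
   functions. *)
exists [seq \row_k nth 0 s (f k) | f : {ffun 'I_d -> 'I_(size s)}] => c cC.
have /choice[w wP] k : exists w : 'I_(size s), rnorm (c 0 k - nth 0 s w) <= e.
  have [w ws h] := sP _ (cC k).
  have wi : (index w s < size s)%N by rewrite index_mem.
  by exists (Ordinal wi) => /=; rewrite nth_index.
exists (\row_k nth 0 s ([ffun k => w k] k)); first by apply: codom_f.
by move=> k; rewrite mxE ffunE.
Qed.

Lemma rnorm_prod (I : finType) (F : I -> R[i]) :
  rnorm (\prod_i F i) = \prod_i rnorm (F i).
Proof.
by elim/big_ind2: _ => [|x a y b <- <-|//]; rewrite ?rnorm1// rnormM.
Qed.

(** Each term of the Leibniz formula has modulus at most [C ^+ d]. This crude bound serves to make
    the supremum in [approx_auerbach] finite. *)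
Lemma rnorm_det_le d (M : 'M[R[i]]_d) (C : R) :
  (forall i j, rnorm (M i j) <= C) -> rnorm (\det M) <= C ^+ d *+ #|'S_d|.
Proof.
move=> MC; rewrite /determinant (le_trans (ler_rnorm_sum _))//.
rewrite -sumr_const big_mkcond/=.
apply: ler_sum => s _; rewrite rnormM.
have -> : rnorm ((-1) ^+ s : R[i]) = 1.
  by case: (s : bool); rewrite ?expr1 ?expr0 ?rnormN rnorm1.
rewrite mul1r rnorm_prod -[d in X in _ <= X]card_ord -prodr_const.
by apply: ler_prod => i _; rewrite rnorm_ge0 MC.
Qed.

End Nets.

(** Cramer's rule, by expansion along row [k]: the coordinates of [c] in the basis of rows of [M]
    are ratios of determinants, so bounds on determinants become bounds on coordinate
    functionals. *)
Lemma cramer_row (K : fieldType) n (M : 'M[K]_n) (c : 'rV[K]_n) k :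
  M \in unitmx ->
  \det M * (c *m invmx M) 0 k =
  \det (\matrix_(i, j) if i == k then c 0 j else M i j).
Proof.
move=> Mu; rewrite [RHS](expand_det_row _ k) /invmx Mu -scalemxAr mxE mulrA.
rewrite divff -?unitfE -?unitmxE// mul1r mxE; apply: eq_bigr => j _.
rewrite !mxE eqxx; congr (_ * _); rewrite /cofactor; congr (_ * \det _).
by apply/matrixP => i l; rewrite !mxE eq_sym (negPf (neq_lift _ _)).
Qed.

(** * Norming vectors and a nearly Auerbach basis for a span of operators *)

Section OperatorBasis.
Context {R : realType} {H : completeNormedModType R[i]}.
Variable inner : {dot H for @Num.conj R[i]}.
Hypothesis inner_norm : forall x : H, `|x| ^+ 2 = inner x x.

(** The supremum of [rnorm (T x)] over the unit ball of [H] need not be attained; [e] is the price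
    of choosing a single vector. *)
Lemma near_norming (T : H -> H) (B e : R) : linear T -> 0 <= B -> 0 < e ->
  (forall v, rnorm (T v) <= B * rnorm v) ->
  exists x, rnorm x <= 1 /\ forall v, rnorm (T v) <= (rnorm (T x) + e) * rnorm v.
Proof.
move=> Tlin B0 e0 TB; pose E := [set rnorm (T x) | x in [set x : H | rnorm x <= 1]].
have T0 : T 0 = 0.
  by rewrite -[X in T X](scale0r 0) (scalable_linear Tlin)/= scale0r.
have Esup : has_sup E.
  split; first by exists (rnorm (T 0)), 0 => //=; rewrite rnorm0.
  exists B => _ [x /= x1 <-]; rewrite (le_trans (TB x))// -[leRHS]mulr1.
  exact: ler_wpM2l.
have [_ [x /= x1 <-] xE] := sup_adherent e0 Esup.
exists x; split=> // v; have [->|v0] := eqVneq v 0.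
  by rewrite T0 !rnorm0 mulr0.
have nv : 0 < rnorm v.
  by rewrite lt_def rnorm_ge0 andbT; apply: contra_neq v0; exact: rnorm_eq0.
pose u := (rnorm v)^-1%:C *: v.
have u1 : rnorm u = 1.
  by rewrite rnormZ rnorm_real ger0_norm ?invr_ge0 ?rnorm_ge0// mulVf ?gt_eqF.
have Tu : rnorm (T u) <= sup E.
  by apply: sup_upper_bound => //; exists u => //=; rewrite u1.
have Tv : rnorm (T u) = (rnorm v)^-1 * rnorm (T v).
  by rewrite (scalable_linear Tlin)/= rnormZ rnorm_real ger0_norm ?invr_ge0 ?rnorm_ge0.
rewrite -ler_pdivrMr// mulrC -Tv; apply: le_trans Tu _.
by rewrite -lerBlDr ltW.
Qed.

Context {d : nat} (b : 'I_d -> H -> H).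
Hypothesis b_linear : forall i, linear (b i).
Hypothesis b_free : forall c : 'I_d -> R[i],
  \sum_i c i *: b i = 0 -> forall i, c i = 0.
Variable B : R.
Hypothesis B_gt0 : 0 < B.
Hypothesis b_bounded : forall i v, rnorm (b i v) <= B * rnorm v.

(** Operators are handled through their rows of coefficients, so that the net and determinant
    arguments take place in a finite dimensional row space. *)
Definition comb (c : 'rV[R[i]]_d) : H -> H := \sum_i c 0 i *: b i.

Lemma combE c x : comb c x = \sum_i c 0 i *: b i x.
Proof. by rewrite /comb fct_sumE. Qed.

Lemma comb_linear c : linear (comb c).
Proof.
move=> a x y; rewrite !combE scaler_sumr -big_split/=; apply: eq_bigr => i _.
by rewrite b_linear scalerDr !scalerA mulrC.
Qed.

Lemma combZ a c x : comb (a *: c) x = a *: comb c x.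
Proof.
by rewrite !combE scaler_sumr; apply: eq_bigr => i _; rewrite !mxE scalerA.
Qed.

Lemma combB c c' x : comb (c - c') x = comb c x - comb c' x.
Proof.
by rewrite !combE -sumrB; apply: eq_bigr => i _; rewrite !mxE scalerBl.
Qed.

Lemma comb_eq0 c : comb c = 0 -> c = 0.
Proof.
by move=> c0; apply/rowP => i; rewrite mxE; apply: (b_free (c := fun i => c 0 i)).
Qed.

Lemma comb_le (c : 'rV[R[i]]_d) (K : R) v : (forall k, rnorm (c 0 k) <= K) ->
  rnorm (comb c v) <= d%:R * K * B * rnorm v.
Proof.
move=> cK; rewrite combE (le_trans (ler_rnorm_sum _))//.
rewrite -!mulrA mulr_natl -[d in X in _ <= X]card_ord -sumr_const.
apply: ler_sum => i _; rewrite rnormZ.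
by rewrite ler_pM ?rnorm_ge0.
Qed.

(** The functionals [T |-> inner (T x) y] separate the combinations of the [b i], so finitely many
    of them form a matrix with a left inverse [Q], which recovers the coefficients from the values
    at finitely many vectors. This takes the place of the equivalence of norms in finite
    dimension. *)
Lemma coef_bound : exists (xs : seq H) (C : R), 0 <= C /\
  forall c K, 0 <= K -> (forall x, x \in xs -> rnorm (comb c x) <= K * rnorm x) ->
    forall k, rnorm (c 0 k) <= C * K.
Proof.
pose S : set 'rV[R[i]]_d :=
  [set s | exists x y, s = \row_j inner (b j x) y].
have [|n [M [SM Mfull]]] := @separating_rows_full _ d S.
  move=> c cS; have c0 : comb c^T = 0.
    (* Testing against [y], the image of [x] itself, turns the functional into the squared norm of
       [y]. *)
    apply/funext => x; set y := comb c^T x.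
    have := cS (\row_j inner (b j x) y) (ex_intro _ x (ex_intro _ y erefl)).
    move=> /matrixP/(_ 0 0); rewrite !mxE => h.
    apply/eqP; rewrite -(dnorm_eq0 inner); apply/eqP.
    rewrite -/y {1}/y combE linear_sumlz -[RHS]h; apply: eq_bigr => i _.
    by rewrite linearZl_LR/= !mxE mulrC.
  by rewrite -[c]trmxK (comb_eq0 c0) trmx0.
have /choice[x /choice[y xyP]] := SM.
have [Q QM] := row_fullP Mfull.
exists [seq x i | i : 'I_n].
exists (\sum_k \sum_l rnorm (Q k l) * (rnorm (x l) * rnorm (y l))).
have Cge0 k : 0 <= \sum_l rnorm (Q k l) * (rnorm (x l) * rnorm (y l)).
  by apply: sumr_ge0 => l _; rewrite !mulr_ge0 ?rnorm_ge0.
split=> [|c K K0 cK k]; first by apply: sumr_ge0 => k _.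
have ck : c 0 k = \sum_l Q k l * inner (comb c (x l)) (y l).
  transitivity ((Q *m M *m c^T) k 0); first by rewrite QM mul1mx mxE.
  rewrite -mulmxA mxE; apply: eq_bigr => l _; congr (_ * _).
  rewrite combE linear_sumlz mxE; apply: eq_bigr => j _.
  have /rowP/(_ j) := xyP l; rewrite !mxE => ->.
  by rewrite linearZl_LR/= mulrC.
have cKl l : rnorm (inner (comb c (x l)) (y l)) <= K * rnorm (x l) * rnorm (y l).
  rewrite (le_trans (rnorm_inner_le inner_norm _ _))// ler_wpM2r ?rnorm_ge0//.
  by rewrite cK ?codom_f.
rewrite ck (le_trans (ler_rnorm_sum _))//.
apply: (@le_trans _ _ (\sum_l rnorm (Q k l) * (rnorm (x l) * rnorm (y l)) * K)).
  apply: ler_sum => l _; rewrite rnormM -mulrA ler_wpM2l ?rnorm_ge0//.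
  by rewrite mulrC mulrA.
rewrite -mulr_suml ler_wpM2r// [leRHS](bigD1 k)//= lerDl.
by apply: sumr_ge0 => i _.
Qed.

Lemma norming_vectors : exists xs : seq H,
  forall c K, 0 <= K -> (forall x, x \in xs -> rnorm (comb c x) <= K * rnorm x) ->
    forall v, rnorm (comb c v) <= 3 / 2 * K * rnorm v.
Proof.
have [xs [C [C0 xsC]]] := coef_bound.
(* Changing coefficients by at most [e] moves an operator by at most 1/6 in norm. An error of 1/6
   occurs three times below: twice in passing between [c] and the net, once in [near_norming]; and 1
   + 3/6 = 3/2. *)
pose e : R := (6 * (d.+1)%:R * B)^-1.
have d0 : 0 < d.+1%:R :> R by rewrite ltr0n.
have e0 : 0 < e by rewrite invr_gt0 !mulr_gt0.
have dB : 0 < 6 * (d.+1)%:R * B by rewrite !mulr_gt0.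
have deB : d%:R * e * B <= 6^-1.
  rewrite /e mulrAC ler_pdivrMr// !mulrA mulVf ?pnatr_eq0// mul1r.
  by rewrite ler_pM2r// ler_nat.
have [net netP] := row_net d C e0.
have small (c g : 'rV[R[i]]_d) v : (forall k, rnorm (c 0 k - g 0 k) <= e) ->
    rnorm (comb c v - comb g v) <= 6^-1 * rnorm v.
  move=> cg; rewrite -combB.
  apply: (@le_trans _ _ (d%:R * e * B * rnorm v)); last by rewrite ler_wpM2r ?rnorm_ge0.
  by apply: comb_le => k; rewrite !mxE.
have nn (g : 'rV[R[i]]_d) : exists x, rnorm x <= 1 /\
    forall v, rnorm (comb g v) <= (rnorm (comb g x) + 6^-1) * rnorm v.
  apply: (@near_norming _ (d%:R * (\sum_k rnorm (g 0 k)) * B)).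
  - exact: comb_linear.
  - by rewrite !mulr_ge0 ?(ltW B_gt0)// sumr_ge0// => k _; exact: rnorm_ge0.
  - by rewrite invr_gt0.
  - move=> v; apply: comb_le => k; rewrite (bigD1 k)//= lerDl.
    by apply: sumr_ge0 => i _; exact: rnorm_ge0.
have [x xP] := choice nn.
(* The vectors [xs] bound the coefficients, which brings [c] close to a point of the net; the
   vectors [map x net] nearly norm the points of the net. *)
exists (xs ++ map x net).
(* Rescaling reduces to [K = 1]. For [K = 0] the coefficients themselves are forced to vanish. *)
suff one c : (forall y, y \in xs ++ map x net -> rnorm (comb c y) <= rnorm y) ->
    forall v, rnorm (comb c v) <= 3 / 2 * rnorm v.
  move=> c K; rewrite le_eqVlt => /orP[/eqP <- cK v|K0 cK v].
    have := @comb_le c 0 v; rewrite !mulr0 !mul0r; apply=> k.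
    by rewrite -[leRHS](mulr0 C); apply: xsC => // y ys; apply: cK; rewrite mem_cat ys.
  have scal y : rnorm (comb (K^-1%:C *: c) y) = K^-1 * rnorm (comb c y).
    by rewrite combZ rnormZ rnorm_real ger0_norm// invr_ge0 ltW.
  have : rnorm (comb (K^-1%:C *: c) v) <= 3 / 2 * rnorm v.
    by apply: one => y /cK; rewrite scal ler_pdivrMl.
  by rewrite scal ler_pdivrMl// mulrCA mulrA.
move=> cy v.
have cC k : rnorm (c 0 k) <= C.
  rewrite -[C]mulr1; apply: xsC => // y ys; rewrite mul1r; apply: cy.
  by rewrite mem_cat ys.
have [g gn cg] := netP c cC.
have [x1 gx] := xP g.
have h1 := small c g v cg.
have h2 := small c g (x g) cg.
have h3 : rnorm (comb c (x g)) <= rnorm (x g).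
  by apply: cy; rewrite mem_cat map_f ?orbT.
have h4 : rnorm (comb g (x g)) <= 1 + 6^-1.
  rewrite -[comb g (x g)](subrK (comb c (x g))) (le_trans (ler_rnormD _ _))//.
  by rewrite rnormB; lra.
have h5 := gx v.
rewrite -[comb c v](subrK (comb g v)) (le_trans (ler_rnormD _ _))//.
have : (rnorm (comb g (x g)) + 6^-1) * rnorm v <= (1 + 6^-1 + 6^-1) * rnorm v.
  by rewrite ler_wpM2r ?rnorm_ge0// lerD2r.
lra.
Qed.

(** Among matrices whose rows represent contractions, one is chosen with determinant above 3/4 of
    the supremum in modulus. Replacing row [k] by another contraction then enlarges the determinant
    by a factor at most 4/3, and by Cramer's rule this factor is the [k]-th coordinate. Near
    maximality spares a compactness argument. *)
Lemma approx_auerbach : exists M : 'M[R[i]]_d,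
  [/\ M \in unitmx,
      forall i v, rnorm (comb (row i M) v) <= rnorm v
    & forall c K, 0 <= K -> (forall v, rnorm (comb c v) <= K * rnorm v) ->
        forall k, rnorm ((c *m invmx M) 0 k) <= 4 / 3 * K].
Proof.
have [xs [C [C0 xsC]]] := coef_bound.
pose contr (M : 'M[R[i]]_d) := forall i v, rnorm (comb (row i M) v) <= rnorm v.
pose E := [set rnorm (\det M) | M in contr].
(* The contractions [B^-1 *: b i] give a nonzero determinant, so the supremum is positive. *)
pose M0 : 'M[R[i]]_d := (B^-1%:C)%:M.
have EM0 : E (rnorm (\det M0)).
  exists M0 => //= i v.
  have -> : row i M0 = B^-1%:C *: delta_mx 0 i.
    by apply/rowP => j; rewrite !mxE eqxx/= eq_sym mulr_natr.
  rewrite combZ combE (bigD1 i)//= big1 ?addr0.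
    rewrite mxE !eqxx scale1r rnormZ rnorm_real ger0_norm ?invr_ge0 ?(ltW B_gt0)//.
    by rewrite ler_pdivrMl.
  by move=> j ji; rewrite mxE (negPf ji) andbF scale0r.
have Esup : has_sup E.
  split; first by exists (rnorm (\det M0)).
  exists (C ^+ d *+ #|{perm 'I_d}|) => _ [M MP <-]; apply: rnorm_det_le => i j.
  have -> : M i j = row i M 0 j by rewrite mxE.
  rewrite -[C]mulr1.
  by apply: xsC => // y _; rewrite mul1r.
have s0 : 0 < sup E.
  apply: lt_le_trans (sup_upper_bound Esup EM0).
  rewrite det_scalar lt_def rnorm_ge0 andbT.
  apply: contraTneq isT => /rnorm_eq0/eqP.
  by rewrite expf_eq0 => /andP[_ /eqP/complexI/eqP]; rewrite invr_eq0 gt_eqF.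
have s4 : 0 < sup E / 4 by rewrite divr_gt0.
have [_ [M MP <-] Ms] := sup_adherent s4 Esup.
have Md : 3 / 4 * sup E < rnorm (\det M) by lra.
have Mu : M \in unitmx.
  rewrite unitmxE unitfE; apply/eqP => M0'.
  by move: Md; rewrite M0' rnorm0; lra.
exists M; split=> // c K; rewrite le_eqVlt => /orP[/eqP <- cK k|K0 cK k].
  rewrite (@comb_eq0 c) ?mul0mx ?mxE ?rnorm0 ?mulr0//.
  apply/funext => v; apply: rnorm_eq0; apply: le_anti.
  by rewrite rnorm_ge0 andbT; have := cK v; rewrite mul0r.
pose c' := K^-1%:C *: c.
pose M' := \matrix_(i, j) if i == k then c' 0 j else M i j.
have M'P : contr M'.
  move=> i v; have [->|ik] := eqVneq i k.
    have -> : row k M' = c' by apply/rowP => j; rewrite !mxE eqxx.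
    rewrite combZ rnormZ rnorm_real ger0_norm ?invr_ge0 ?(ltW K0)//.
    by rewrite ler_pdivrMl.
  have -> : row i M' = row i M by apply/rowP => j; rewrite !mxE (negPf ik).
  exact: MP.
have : rnorm (\det M') <= sup E by apply: sup_upper_bound => //; exists M'.
rewrite -cramer_row// rnormM -scalemxAl mxE rnormM rnorm_real.
rewrite ger0_norm ?invr_ge0 ?(ltW K0)// => h.
have h2 : sup E * (K^-1 * rnorm ((c *m invmx M) 0 k)) <= sup E * (4 / 3).
  have : 3 / 4 * sup E * (K^-1 * rnorm ((c *m invmx M) 0 k)) <= sup E.
    apply: le_trans h; rewrite ler_wpM2r ?(ltW Md)//.
    by rewrite mulr_ge0 ?rnorm_ge0 ?invr_ge0 ?(ltW K0).
  by lra.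
by move: h2; rewrite ler_pM2l// ler_pdivrMl// mulrC.
Qed.

End OperatorBasis.

(** * From extended-real operator norms to pointwise bounds *)

Section OperatorNorm.
Context {R : realType}.

Lemma opnorm_leP (V : lmodType R[i]) (N : V -> R) (T : V -> V) (K : R) :
  (forall x, 0 <= N x) -> (forall (a : R) x, 0 <= a -> N (a%:C *: x) = a * N x) ->
  (forall a x, T (a *: x) = a *: T x) ->
  (opnorm N T <= K%:E)%E -> forall x, N (T x) <= K * N x.
Proof.
move=> N0 NZ TZ TK x.
have ball y : N y <= 1 -> N (T y) <= K.
  move=> y1; rewrite -lee_fin; apply: le_trans TK.
  by apply: ereal_sup_ubound; exists y.
have scal (a : R) : 0 <= a -> N (T (a%:C *: x)) = a * N (T x).
  by move=> a0; rewrite TZ NZ.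
have := N0 x; rewrite le_eqVlt => /orP[/eqP x0|x0].
  (* If [N x = 0], all multiples of [x] lie in the unit ball, and one of them would be sent to a
     vector of size [K + 1]. *)
  rewrite -x0 mulr0 leNgt; apply/negP => Tx.
  have K0 : 0 <= K by apply: le_trans (ball x _); rewrite -?x0.
  have a0 : 0 <= (K + 1) / N (T x) by rewrite divr_ge0 ?addr_ge0.
  have := ball (((K + 1) / N (T x))%:C *: x).
  by rewrite scal// NZ// -x0 mulr0 divfK ?gt_eqF// => /(_ ler01); lra.
have a0 : 0 <= (N x)^-1 by rewrite invr_ge0 ltW.
have := ball ((N x)^-1%:C *: x).
rewrite scal// NZ// mulVf ?gt_eqF// => /(_ (lexx _)).
by rewrite ler_pdivrMl// mulrC.
Qed.

Lemma bounded_operatorP (H : completeNormedModType R[i]) (T : H -> H) :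
  bounded_operator T -> exists K, forall v, rnorm (T v) <= K * rnorm v.
Proof.
move=> [Tlin Tfin].
have [K TK] : exists K : R, (opnorm (@hnorm R H) T <= K%:E)%E.
  (* The formal case [-oo] admits any bound, here 0. *)
  by case: (opnorm _ _) Tfin => [s| |]// _; [exists s|exists 0; rewrite leNye].
exists K; apply: opnorm_leP TK => [x|a x a0|a x].
- exact: rnorm_ge0.
- by rewrite -[LHS]/(rnorm _) rnormZ rnorm_real ger0_norm.
- exact: scalable_linear.
Qed.

End OperatorNorm.

(** * Ampliations of a functional are bounded by its norm *)

Section FunctionalAmpliation.
Context {R : realType} {H : completeNormedModType R[i]}.
Variable inner : {dot H for @Num.conj R[i]}.
Hypothesis inner_norm : forall x : H, `|x| ^+ 2 = inner x x.
Context {d n : nat} (b : 'I_d -> H -> H) (y : 'I_n -> 'I_n -> 'rV[R[i]]_d).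
Variables (q : 'cV[R[i]]_d) (L : set H) (G : R).
Hypothesis b_linear : forall i, linear (b i).
Hypothesis L_scale : forall a v, L v -> L (a *: v).
Hypothesis G_ge0 : 0 <= G.
Hypothesis q_bound : forall c K, 0 <= K ->
  (forall v, L v -> rnorm (comb b c v) <= K * rnorm v) -> rnorm ((c *m q) 0 0) <= G * K.
Hypothesis y_contr : forall u : 'I_n -> H, (forall j, L (u j)) ->
  l2norm (@rnorm R H) (fun i => \sum_j comb b (y i j) (u j)) <= l2norm (@rnorm R H) u.

Let f (c : 'rV[R[i]]_d) := (c *m q) 0 0.

Let f_sum (I : finType) (a : I -> R[i]) (c : I -> 'rV[R[i]]_d) :
  f (\sum_i a i *: c i) = \sum_i a i * f (c i).
Proof.
by rewrite /f mulmx_suml summxE; apply: eq_bigr => i _; rewrite -scalemxAl mxE.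
Qed.

Let comb_sum (I : finType) (a : I -> R[i]) (c : I -> 'rV[R[i]]_d) v :
  comb b (\sum_i a i *: c i) v = \sum_i a i *: comb b (c i) v.
Proof.
rewrite combE; under eq_bigr do rewrite summxE scaler_suml.
rewrite exchange_big; apply: eq_bigr => i _; rewrite combE scaler_sumr.
by apply: eq_bigr => k _; rewrite !mxE scalerA.
Qed.

(* With [w := f(y) z], the number [|w|^2] is the value of [f] at
   [sum_i conj(w i) sum_j z j y i j], whose norm on [L] is at most [|w||z|]. *)
Lemma scalar_ampliation_le (z : 'I_n -> R[i]) :
  l2norm (@rnorm R R[i]) (fun i => \sum_j f (y i j) * z j) <=
  G * l2norm (@rnorm R R[i]) z.
Proof.
set w := fun i => _; set W := l2norm _ w; set Z := l2norm _ z.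
have W0 : 0 <= W := l2norm_ge0 _ w; have Z0 : 0 <= Z := l2norm_ge0 _ z.
pose s i := \sum_j z j *: y i j; pose c := \sum_i (w i)^* *: s i.
have fs i : f (s i) = w i by rewrite f_sum; apply: eq_bigr => j _; rewrite mulrC.
have fc : f c = (W ^+ 2)%:C.
  rewrite f_sum l2norm_sqr rmorph_sum; apply: eq_bigr => i _.
  by rewrite fs mulrC mul_conj_rnorm.
have cL v : L v -> rnorm (comb b c v) <= (W * Z) * rnorm v.
  move=> Lv; rewrite comb_sum (le_trans (ler_rnorm_sum _))//.
  pose h i := \sum_j comb b (y i j) (z j *: v).
  apply: (@le_trans _ _ (\sum_i rnorm (w i) * rnorm (h i))).
    apply: ler_sum => i _; rewrite rnormZ rnorm_conj comb_sum le_eqVlt.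
    apply/orP; left; apply/eqP; congr (_ * rnorm _); apply: eq_bigr => j _.
    by rewrite (scalable_linear (comb_linear b_linear _)).
  (* Cauchy-Schwarz over [i], then [y_contr] for the family [z j *: v], whose l2 norm is
     [Z * rnorm v]. *)
  rewrite (le_trans (sum_mul_le_sqrt _ _))// -mulrA ler_wpM2l//.
  rewrite (le_trans (y_contr _))// => [j|]; first exact: L_scale.
  apply: l2norm_le; first by rewrite mulr_ge0 ?rnorm_ge0.
  rewrite exprMn l2norm_sqr mulr_suml le_eqVlt; apply/orP; left; apply/eqP.
  by apply: eq_bigr => j _; rewrite rnormZ exprMn.
have := q_bound (mulr_ge0 W0 Z0) cL; rewrite -/(f c) fc rnorm_real.
rewrite ger0_norm ?sqr_ge0// expr2 mulrCA.
have := W0; rewrite le_eqVlt => /orP[/eqP <- _|Wp]; first exact: mulr_ge0.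
by rewrite ler_pM2l.
Qed.

(** In an orthonormal family whose span contains the [x j], the scalar matrix [f (y i j)] acts on
    each coordinate separately. The scalar case applies to every coordinate, and the squared norms
    add up. *)
Lemma functional_ampliation_le (x : 'I_n -> H) :
  l2norm (@rnorm R H) (fun i => \sum_j f (y i j) *: x j) <=
  G * l2norm (@rnorm R H) x.
Proof.
have [r [e [eo xe _]]] := gram_schmidt inner_norm [seq x j | j : 'I_n].
pose X l j := inner (x j) (e l).
have xX j : x j = \sum_l X l j *: e l by apply: xe; apply: codom_f.
apply: l2norm_le; first by rewrite mulr_ge0 ?l2norm_ge0.
have -> : \sum_i rnorm (\sum_j f (y i j) *: x j) ^+ 2 =
    \sum_l l2norm (@rnorm R R[i]) (fun i => \sum_j f (y i j) * X l j) ^+ 2.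
  under [RHS]eq_bigr do rewrite l2norm_sqr.
  rewrite exchange_big; apply: eq_bigr => i _.
  rewrite -[RHS](l2norm_sqr _ (fun l => \sum_j f (y i j) * X l j)).
  rewrite -(rnorm_sum_orthonormal inner_norm _ eo); congr (rnorm _ ^+ 2).
  under [RHS]eq_bigr do rewrite scaler_suml.
  rewrite exchange_big; apply: eq_bigr => j _.
  by rewrite {1}xX scaler_sumr; apply: eq_bigr => l _; rewrite scalerA.
apply: (@le_trans _ _ (\sum_l (G * l2norm (@rnorm R R[i]) (X l)) ^+ 2)).
  apply: ler_sum => l _; rewrite ler_pXn2r ?nnegrE ?mulr_ge0 ?l2norm_ge0//.
  exact: scalar_ampliation_le.
under eq_bigr do rewrite exprMn l2norm_sqr.
rewrite -mulr_sumr exprMn l2norm_sqr exchange_big le_eqVlt; apply/orP; left; apply/eqP.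
congr (_ * _); apply: eq_bigr => j _.
by rewrite [in RHS]xX (rnorm_sum_orthonormal inner_norm _ eo) l2norm_sqr.
Qed.

End FunctionalAmpliation.

(** * Compression to a finite dimensional invariant subspace *)

Section Compression.
Context {R : realType} {H : completeNormedModType R[i]}.
Variable inner : {dot H for @Num.conj R[i]}.
Hypothesis inner_norm : forall x : H, `|x| ^+ 2 = inner x x.
Context {r : nat} (e : 'I_r -> H).
Hypothesis eo : orthonormal_family inner e.

Definition embed (v : 'cV[R[i]]_r) : H := \sum_i v i 0 *: e i.

Definition compress (T : H -> H) : 'M[R[i]]_r :=
  \matrix_(i, j) inner (T (e j)) (e i).

Lemma rnorm_embed v : rnorm (embed v) = euclid_norm v.
Proof. exact: (rnorm_sum_orthonormal inner_norm (fun i => v i 0) eo). Qed.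

Lemma embed_linear : linear embed.
Proof.
move=> a u v; rewrite /embed scaler_sumr -big_split/=; apply: eq_bigr => i _.
by rewrite !mxE scalerDl scalerA.
Qed.

Lemma embed_sum (I : finType) (v : I -> 'cV[R[i]]_r) :
  embed (\sum_k v k) = \sum_k embed (v k).
Proof.
rewrite /embed exchange_big; apply: eq_bigr => i _.
by rewrite summxE scaler_suml.
Qed.

Lemma embed_delta j : embed (delta_mx j 0) = e j.
Proof.
rewrite /embed (bigD1 j)//= mxE !eqxx scale1r big1 ?addr0// => i ij.
by rewrite mxE (negPf ij) scale0r.
Qed.

Definition span_invariant (T : H -> H) :=
  linear T /\ forall j, T (e j) = \sum_i inner (T (e j)) (e i) *: e i.

(** Invariance makes the compression a restriction. This intertwining relation yields
    multiplicativity and translates matrix norms into norms on the span of [e]. *)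
Lemma embed_compress T v : span_invariant T -> embed (compress T *m v) = T (embed v).
Proof.
move=> [Tlin Te].
have TD : {morph T : x y / x + y}.
  by move=> x y; rewrite -{1}[x]scale1r Tlin scale1r.
have T0 : T 0 = 0 by rewrite -[X in T X](scale0r 0) (scalable_linear Tlin)/= scale0r.
rewrite /embed (big_morph T TD T0).
under [LHS]eq_bigr do rewrite mxE scaler_suml.
rewrite exchange_big; apply: eq_bigr => j _.
rewrite (scalable_linear Tlin)/= Te scaler_sumr; apply: eq_bigr => i _.
by rewrite !mxE scalerA mulrC.
Qed.

Lemma compress_comp S T : span_invariant S -> span_invariant T ->
  compress (S \o T) = compress S *m compress T.
Proof.
move=> Si Ti; apply/matrixP => i j; rewrite [LHS]mxE /= -embed_delta -embed_compress//.
rewrite -embed_compress// inner_sum_orthonormal// mulmxA -colE.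
by rewrite mxE.
Qed.

Lemma compress_linear : linear compress.
Proof.
move=> a S T; apply/matrixP => i j; rewrite !mxE.
by rewrite -[(a *: S + T) (e j)]/(a *: S (e j) + T (e j)) linearDl/= linearZl_LR.
Qed.

Lemma compress_id : compress idfun = 1%:M.
Proof. by apply/matrixP => i j; rewrite !mxE eo eq_sym. Qed.

Lemma l2norm_embed n (t : 'I_n -> 'cV[R[i]]_r) :
  l2norm (@rnorm R H) (fun i => embed (t i)) = l2norm (@euclid_norm R r) t.
Proof.
by rewrite /l2norm; congr Num.sqrt; apply: eq_bigr => i _; rewrite rnorm_embed.
Qed.

Lemma embed_mx_apply n (X : 'M[H -> H]_n) (t : 'I_n -> 'cV[R[i]]_r) :
  (forall i j, span_invariant (X i j)) ->
  l2norm (@euclid_norm R r) (fun i => \sum_j map_mx compress X i j *m t j) =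
  l2norm (@rnorm R H) (fun i => \sum_j X i j (embed (t j))).
Proof.
move=> Xi; rewrite -l2norm_embed /l2norm; congr Num.sqrt; apply: eq_bigr => i _.
rewrite embed_sum; congr (rnorm _ ^+ 2); apply: eq_bigr => j _.
by rewrite mxE embed_compress.
Qed.

(** As [embed] is isometric, the norm of a compressed matrix of operators is a supremum over those
    vectors of the unit ball with components in the span of [e], at every matrix size. *)
Lemma compress_cb_contraction (A : set (H -> H)) :
  (forall T, A T -> span_invariant T) ->
  (cb_norm (@bh_mxnorm R H) (@mr_mxnorm R r) A compress <= 1)%E.
Proof.
move=> Ainv; apply: ge_ereal_sup => _ [n _ <-].
apply: ge_ereal_sup => _ [X [XA X1] <-].
apply: ge_ereal_sup => _ [t /= t1 <-].
rewrite embed_mx_apply; last by move=> i j; exact/Ainv/XA.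
apply: le_trans X1; apply: ereal_sup_ubound.
exists (fun j => embed (t j)) => //=.
by rewrite -[X in X <= _]/(l2norm (@rnorm R H) _) l2norm_embed.
Qed.

End Compression.

(** * The invariant subspace and the cb-norm of the inverse *)

Section Model.
Context {R : realType} {H : completeNormedModType R[i]}.
Variable inner : {dot H for @Num.conj R[i]}.
Hypothesis inner_norm : forall x : H, `|x| ^+ 2 = inner x x.
Variable A : set (H -> H).
Hypothesis A_alg : operator_algebra A.

Lemma operator_algebra0 : A 0.
Proof. by case: A_alg => _ [+ _] _ _; rewrite inE. Qed.

Lemma operator_algebraZD a S T : A S -> A T -> A (a *: S + T).
Proof.
move=> AS AT; case: A_alg => _ [_ AL] _ _.
by have := AL a S T; rewrite !inE; apply.
Qed.

Lemma operator_algebra_linear T : A T -> linear T.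
Proof. by case: A_alg => Ab _ _ _ /Ab[]. Qed.

Lemma operator_algebra_comp S T : A S -> A T -> A (S \o T).
Proof. by case: A_alg => _ _ + _; apply. Qed.

Lemma in_span_linear r (e : 'I_r -> H) a (u v : H) :
  u = \sum_i inner u (e i) *: e i -> v = \sum_i inner v (e i) *: e i ->
  a *: u + v = \sum_i inner (a *: u + v) (e i) *: e i.
Proof.
move=> ue ve; rewrite {1}ue {1}ve scaler_sumr -big_split/=; apply: eq_bigr => i _.
by rewrite linearDl/= linearZl_LR/= scalerDl scalerA.
Qed.

(** The span of [xs] and of all [b i x] is invariant: [T x] is a combination of the [b i x], and
    [T (b i x)] is the value at [x] of [T \o b i], again in [A]. The vectors [xs] are listed
    separately because [A] may lack the identity. *)
Lemma invariant_frame d (b : 'I_d -> H -> H) (xs : seq H) :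
  (forall i, A (b i)) -> (forall T, A T -> exists c, T = comb b c) ->
  exists r (e : 'I_r -> H),
    [/\ orthonormal_family inner e,
        forall T, A T -> span_invariant inner e T
      & forall x, x \in xs -> x = \sum_i inner x (e i) *: e i].
Proof.
move=> bA Aspan.
have [r [e [eo es eP]]] :=
  gram_schmidt inner_norm (xs ++ [seq b i x | i <- enum 'I_d, x <- xs]).
exists r, e; split=> // [T AT|x xxs]; last by apply: es; rewrite mem_cat xxs.
pose L : set H := fun v => v = \sum_i inner v (e i) *: e i.
have LD a u v : L u -> L v -> L (a *: u + v) by exact: in_span_linear.
have L0 : L 0 by rewrite /L big1// => i _; rewrite linear0l scale0r.
have Lx S x : A S -> x \in xs -> L (S x).
  move=> /Aspan[c ->] xxs; rewrite combE; elim/big_ind: _ => // [u v Lu Lv|i _].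
    by rewrite -[u]scale1r; exact: LD.
  rewrite -[_ *: _]addr0; apply: (LD) => //; apply: es.
  by rewrite mem_cat allpairs_f ?orbT// mem_enum.
have Tlin := operator_algebra_linear AT.
(* The vectors that [T] sends into [L] form a subspace, so it is enough to check the generators
   given to [gram_schmidt]. *)
split=> //; apply: (eP [set v | L (T v)]) => [|a x y /= LTx LTy|x] /=.
- by rewrite -[X in T X](scale0r 0) (scalable_linear Tlin)/= scale0r.
- by rewrite Tlin; exact: LD.
- rewrite mem_cat => /orP[|/allpairsP[[i z] /= [_ zs ->]]]; first exact: Lx.
  exact: (Lx (T \o b i) z (operator_algebra_comp AT (bA i)) zs).
Qed.

(** In the basis given by the rows of [M], [Psi] is a sum of [d] terms, each a coordinate functional
    times a fixed contraction. Each functional is bounded by 2 relative to the norm on the span of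
    [e], hence so are its ampliations, and the triangle inequality gives [2 * d]. *)
Lemma inverse_cb_bound d (b : 'I_d -> H -> H) r (e : 'I_r -> H)
    (M : 'M[R[i]]_d) (Psi : 'M[R[i]]_r -> H -> H) :
  (forall i, A (b i)) -> (forall T, A T -> exists c, T = comb b c) ->
  orthonormal_family inner e -> (forall T, A T -> span_invariant inner e T) ->
  M \in unitmx -> (forall i v, rnorm (comb b (row i M) v) <= rnorm v) ->
  (forall c K, 0 <= K ->
    (forall u, rnorm (comb b c (embed e u)) <= K * rnorm (embed e u)) ->
    forall k, rnorm ((c *m invmx M) 0 k) <= 2 * K) ->
  (forall T, A T -> Psi (compress inner e T) = T) ->
  (cb_norm (@mr_mxnorm R r) (@bh_mxnorm R H) (compress inner e @` A) Psi
    <= (2 * d)%:R%:E)%E.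
Proof.
move=> bA Aspan eo Ainv Mu Mcontr MK PsiK.
have blin i : linear (b i) by exact/operator_algebra_linear/bA.
apply: ge_ereal_sup => _ [n _ <-].
apply: ge_ereal_sup => _ [X [XB X1] <-].
have yP (ij : 'I_n * 'I_n) : exists c,
    A (comb b c) /\ compress inner e (comb b c) = X ij.1 ij.2.
  have [T AT TX] := XB ij.1 ij.2; have [c Tc] := Aspan T AT.
  by exists c; rewrite -Tc.
have [y' y'P] := choice yP; pose y i j := y' (i, j).
have yA i j : A (comb b (y i j)) by case: (y'P (i, j)).
have yX : X = map_mx (compress inner e) (\matrix_(i, j) comb b (y i j)).
  by apply/matrixP => i j; rewrite !mxE; case: (y'P (i, j)).
have PsiX i j : map_mx Psi X i j = comb b (y i j).
  by rewrite yX !mxE PsiK.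
pose L := range (embed e).
(* The norm bound on the scalar matrix [X] says that the lifted matrix of operators is contractive
   on vectors with components in [L]. *)
have y_contr (u : 'I_n -> H) : (forall j, L (u j)) ->
    l2norm (@rnorm R H) (fun i => \sum_j comb b (y i j) (u j)) <=
    l2norm (@rnorm R H) u.
  move=> uL; have /choice[t tu] j : exists t, embed e t = u j.
    by have [t _ <-] := uL j; exists t.
  have -> : u = fun j => embed e (t j) by apply/funext => j.
  rewrite (l2norm_embed inner_norm eo).
  have := @opnorm_leP _ _ _ _ 1 _ _ _ X1 t; rewrite mul1r => h.
  apply: le_trans (h _ _ _).
  - rewrite yX embed_mx_apply//.
      by rewrite le_eqVlt; apply/orP; left; apply/eqP; congr (l2norm _ _);
        apply/funext => i; apply: eq_bigr => j _; rewrite mxE.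
    by move=> i j; rewrite mxE; exact: Ainv.
  - by move=> z; exact: l2norm_ge0.
  - move=> a x a0; rewrite -!(l2norm_embed inner_norm eo) /l2norm.
    under eq_bigr do rewrite (scalable_linear (embed_linear e))/= rnormZ rnorm_real
      ger0_norm// exprMn.
    by rewrite -mulr_sumr sqrtrM ?sqr_ge0// sqrtr_sqr ger0_norm.
  - move=> a x; apply/funext => i /=.
    rewrite -[RHS]/(a *: \sum_j X i j *m x j) scaler_sumr; apply: eq_bigr => j _.
    by rewrite -scalemxAr.
apply: ge_ereal_sup => _ [x /= x1 <-]; rewrite lee_fin.
pose b' k := comb b (row k M).
have expand c v : comb b c v = \sum_k (c *m invmx M) 0 k *: b' k v.
  rewrite -{1}[c](mulmxKV Mu) combE.
  under eq_bigr do rewrite mxE scaler_suml.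
  rewrite exchange_big; apply: eq_bigr => k _; rewrite /b' combE scaler_sumr.
  by apply: eq_bigr => j _; rewrite scalerA [row k M 0 j]mxE.
pose q k := col k (invmx M).
have qE c k : (c *m q k) 0 0 = (c *m invmx M) 0 k.
  by rewrite /q !mxE; apply: eq_bigr => j _; rewrite !mxE.
have -> : (fun i => \sum_j map_mx Psi X i j (x j)) =
    fun i => \sum_k \sum_j (y i j *m q k) 0 0 *: b' k (x j).
  apply/funext => i; rewrite exchange_big; apply: eq_bigr => j _.
  by rewrite PsiX expand; apply: eq_bigr => k _; rewrite qE.
apply: le_trans (l2norm_sum _) _.
apply: (@le_trans _ _ (\sum_(k < d) 2)); last first.
  by rewrite sumr_const card_ord natrM mulr_natr.
apply: ler_sum => k _.
have := @functional_ampliation_le _ _ _ inner_norm _ _ b y (q k) L 2 blin _ _ _ y_contr.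
move=> h; apply: le_trans (h _ _ _ (fun j => b' k (x j))) _.
- move=> a _ [u _ <-]; exists (a *: u) => //.
  by rewrite (scalable_linear (embed_linear e)).
- by [].
- by move=> c K K0 cK; rewrite qE; apply: MK => // u; apply: cK; exists u.
(* Applying the contraction [b' k] to each component does not increase the l2 norm of [x]. *)
rewrite -[leRHS]mulr1 ler_wpM2l//; apply: le_trans x1.
rewrite /l2norm ler_sqrt ?sqr_sum_ge0//; apply: ler_sum => j _.
by rewrite ler_pXn2r ?nnegrE ?rnorm_ge0//; exact: Mcontr.
Qed.

End Model.

(** * The zero algebra and the assembly of the representation *)

Lemma l2norm0 (R : realType) (V : Type) (N : V -> R) n (x : 'I_n -> V) :
  (forall i, N (x i) = 0) -> l2norm N x = 0.
Proof.
by move=> x0; rewrite /l2norm big1 ?sqrtr0// => i _; rewrite x0 expr0n.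
Qed.

(** Dimension 0 is treated apart, since the general argument gets [1 <= r] from a nonzero basis
    operator. Here the inverse has to have cb-norm at most 0. *)
Lemma zero_algebra_model (R : realType) (H : completeNormedModType R[i])
    (A : set (H -> H)) : A = [set 0] ->
  [/\ matrix_subalgebra [set 0 : 'M[R[i]]_1],
      algebra_iso A [set 0 : 'M[R[i]]_1] (fun=> 0) (fun=> 0),
      (cb_norm (@bh_mxnorm R H) (@mr_mxnorm R 1) A (fun=> 0%R) <= 1)%E
    & (cb_norm (@mr_mxnorm R 1) (@bh_mxnorm R H) [set 0%R] (fun=> 0%R) <= 0)%E].
Proof.
move=> ->; split.
- split=> [|M N -> ->]; last by rewrite mulmx0.
  by split=> [|a M N]; rewrite !inE // => -> ->; rewrite scaler0 addr0.
- by split=> [a S T _ _|S T _ _|T ->|M ->] //; rewrite ?scaler0 ?addr0 ?mulmx0.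
- apply: ge_ereal_sup => _ [n _ <-]; apply: ge_ereal_sup => _ [X _ <-].
  apply: ge_ereal_sup => _ [t _ <-]; rewrite lee_fin l2norm0// => i.
  rewrite big1 => [|j _]; last by rewrite mxE mul0mx.
  by rewrite /euclid_norm l2norm0// => k; rewrite mxE normr0.
- apply: ge_ereal_sup => _ [n _ <-]; apply: ge_ereal_sup => _ [X _ <-].
  apply: ge_ereal_sup => _ [t _ <-]; rewrite lee_fin l2norm0// => i.
  by rewrite big1 => [|j _]; rewrite ?mxE// /hnorm normr0.
Qed.

Theorem proposition3p2 (R : realType) (H : completeNormedModType R[i])
    (inner : {dot H for @Num.conj R[i]})
    (inner_norm : forall x : H, `|x| ^+ 2 = inner x x)
    (A : set (H -> H)) (d : nat)
    (A_alg : operator_algebra A) (A_dim : has_dimension A d) :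
  exists (r : nat) (B : set 'M[R[i]]_r)
         (Phi : (H -> H) -> 'M[R[i]]_r) (Psi : 'M[R[i]]_r -> (H -> H)),
    [/\ (1 <= r)%N,
        matrix_subalgebra B,
        algebra_iso A B Phi Psi,
        (cb_norm (@bh_mxnorm R H) (@mr_mxnorm R r) A Phi <= 1)%E
      & (cb_norm (@mr_mxnorm R r) (@bh_mxnorm R H) B Psi <= (2 * d)%:R%:E)%E
        /\ ((exists x : H, x != 0) -> A idfun -> Phi idfun = 1%:M)].
Proof.
have [b [bA b_free b_span]] := A_dim.
have A0 := operator_algebra0 A_alg.
case: d => [|d] in A_dim b bA b_free b_span *.
  have A_eq0 : A = [set 0].
    by apply/seteqP; split=> [T /b_span[c ->]|T -> //]; rewrite big_ord0.
  have [sB iso cPhi cPsi] := zero_algebra_model A_eq0.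
  exists 1%N, [set 0], (fun=> 0), (fun=> 0); split=> //; split=> // -[x /eqP x0].
  (* A nonzero vector distinguishes [idfun] from 0, so the unital clause is vacuous. *)
  by rewrite A_eq0 => /(congr1 (fun f => f x)) /x0.
have blin i : linear (b i) by exact: (operator_algebra_linear A_alg).
have Aspan T : A T -> exists c, T = comb b c.
  move=> /b_span[c ->]; exists (\row_i c i); rewrite /comb.
  by apply: eq_bigr => i _; rewrite mxE.
have [B B0 bB] : exists2 B : R, 0 < B & forall i v, rnorm (b i v) <= B * rnorm v.
  have Ab : A `<=` @bounded_operator R H by case: A_alg.
  have /choice[K bK] i := bounded_operatorP (Ab _ (bA i)).
  exists (1 + \sum_i `|K i|); first by rewrite ltr_pwDl// sumr_ge0.
  move=> i v; rewrite (le_trans (bK i v))// ler_wpM2r ?rnorm_ge0//.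
  rewrite (le_trans (ler_norm _))// (bigD1 i)//= addrCA lerDl.
  by rewrite addr_ge0// sumr_ge0.
have [xs xsP] := norming_vectors inner_norm blin b_free B0 bB.
have [M [Mu Mcontr MK]] := approx_auerbach inner_norm b_free B0 bB.
have [r [e [eo Ainv es]]] := invariant_frame inner_norm A_alg xs bA Aspan.
have xs_embed x : x \in xs -> exists u, x = embed e u.
  move=> /es {1}->; exists (\col_i inner x (e i)).
  by rewrite /embed; apply: eq_bigr => i _; rewrite mxE.
have Phi_inj S T : A S -> A T -> compress inner e S = compress inner e T -> S = T.
  move=> AS AT ST.
  have [c cE] : exists c, S - T = comb b c.
    by apply: Aspan; rewrite addrC -scaleN1r; exact: (operator_algebraZD A_alg).
  apply/eqP; rewrite -subr_eq0 cE; apply/eqP/funext => v; apply: rnorm_eq0.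
  apply: le_anti; rewrite rnorm_ge0 andbT.
  (* The difference vanishes on [xs], so the norming property with [K = 0] makes it vanish
     everywhere. *)
  rewrite -(mul0r (rnorm v)) -[X in X * _](mulr0 (3 / 2)).
  apply: xsP => // x /xs_embed[u ->].
  rewrite -cE mul0r -[(S - T) _]/(S (embed e u) - T (embed e u)).
  have [Si Ti] := (Ainv _ AS, Ainv _ AT).
  by rewrite -(embed_compress u Si) -(embed_compress u Ti) ST subrr rnorm0.
pose Phi := compress inner e.
(* The preimage in [A], with default value 0 outside the image of [A]. *)
pose Psi (X : 'M[R[i]]_r) : H -> H := xget 0 [set T | A T /\ Phi T = X].
have PsiP X : (Phi @` A) X -> A (Psi X) /\ Phi (Psi X) = X.
  by move=> [T AT TX]; apply: (@xgetPex _ 0 [set T | A T /\ Phi T = X]); exists T.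
have PsiK T : A T -> Psi (Phi T) = T.
  move=> AT; have [APsi PhiPsi] := PsiP (Phi T) (ex_intro2 _ _ T AT erefl).
  exact: Phi_inj.
exists r, (Phi @` A), Phi, Psi; split.
(* For [r = 0] all compressions coincide, so injectivity would make every [b i] zero, against
   freeness; [d] is now a successor, so there is an index. *)
- case: r e {eo Ainv es xs_embed Phi Psi PsiP PsiK} Phi_inj => // e Phi_inj.
  have b0 i : b i = 0 by apply: Phi_inj => //; apply/matrixP => - [].
  suff /eqP : 1 = 0 :> R[i] by rewrite oner_eq0.
  by apply: (b_free (fun=> 1) _ ord0); rewrite big1// => i _; rewrite b0 scaler0.
- split; first split.
  + rewrite inE; exists 0 => //.
    by apply/matrixP => i j; rewrite !mxE linear0l.
  + move=> a X Y; rewrite !inE => -[S AS <-] [T AT <-].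
    by exists (a *: S + T); [exact: operator_algebraZD|rewrite /Phi compress_linear].
  + move=> X Y [S AS <-] [T AT <-]; exists (S \o T).
      exact: (operator_algebra_comp A_alg).
    by rewrite /Phi (compress_comp eo)//; exact: Ainv.
- split=> //.
  + by move=> a S T _ _; exact: compress_linear.
  + by move=> S T AS AT; apply: (compress_comp eo); exact: Ainv.
  + by move=> T AT; split; [exists T|exact: PsiK].
- exact: (compress_cb_contraction inner_norm eo Ainv).
- split; last by move=> _ _; exact: compress_id.
  apply: (inverse_cb_bound inner_norm A_alg bA Aspan eo Ainv Mu Mcontr) => //.
  (* A bound [K] on the span of [e], which contains [xs], gives [3 / 2 * K] on all of [H]; the
     coordinate functionals contribute 4/3. *)
  move=> c K K0 cK k; rewrite (_ : 2 * K = 4 / 3 * (3 / 2 * K)); last by field.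
  apply: MK; first by rewrite mulr_ge0.
  by apply: xsP => // x /xs_embed[u ->].
Qed.
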